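(* Consider a frustration-free quantum spin model with non-negative interaction terms on a lattice $\Gamma$ (see context). Let $\Lambda\subseteq\Gamma$ be finite, and let $\mathcal{V}_\Lambda\subseteq\mathcal{H}_\Lambda$ be a subspace with $\mathcal{V}_\Lambda\cap\mathcal{G}_\Lambda\ne\{0\}$. Suppose there is a finite sequence $X_n\subseteq\Lambda$, $1\le n\le N$, such that, with $\Lambda_n:=\bigcup_{i=1}^nX_i$: (i) there is $\gamma>0$ so that $\gamma\langle\psi,(1-G_{X_n})\psi\rangle\le\langle\psi,H_{X_n}\psi\rangle$ for all $1\le n\le N$ and all $\psi\in\mathcal{V}_\Lambda$; (ii) there is $d\ge1$ so that $H_\Lambda\le\sum_{i=1}^NH_{X_i}\le d\,H_\Lambda$; (iii) there is an integer $\ell\ge1$ so that for all $m\le n\le N$, $X_m\cap X_n\ne\emptyset$ implies $m\in[n-\ell+1,n]$; (iv) with $G_{\Lambda_0}:=1$, $G_{\Lambda_{N+1}}:=0$ and $E_n:=G_{\Lambda_n}-G_{\Lambda_{n+1}}$ for $0\le n\le N$, $$\epsilon:=\sup_{0\le n\le N-1}\|G_{X_{n+1}}\|_{E_n\mathcal{V}_\Lambda}<\frac1{\sqrt\ell}.$$ Then $$\langle\psi,H_\Lambda\psi\rangle\ \ge\ \frac{\gamma}{d}\big(1-\epsilon\sqrt\ell\big)^2\|\psi\|^2\qquad\text{for all }\psi\in\mathcal{G}_\Lambda^\perp\cap\mathcal{V}_\Lambda.$$ (The subspace $\mathcal{V}_\Lambda$ is not assumed to be invariant under any of these operators.)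
   Context: Setting: $\mathcal{H}_\Lambda=\bigotimes_{x\in\Lambda}\mathbb{C}^{n_x}$ for finite $\Lambda\subseteq\Gamma$. An interaction assigns to finite $Y\subseteq\Gamma$ a self-adjoint $h_Y\ge0$ on $\mathcal{H}_Y$, and the local Hamiltonian on $\Lambda'$ is $H_{\Lambda'}=\sum_{Y\subseteq\Lambda'}h_Y$; operators on $\mathcal{H}_{\Lambda'}$ are regarded as operators on $\mathcal{H}_\Lambda$ for $\Lambda'\subseteq\Lambda$ by tensoring with the identity. Frustration-free means that $\ker(H_{\Lambda'})\ne\{0\}$ for every finite $\Lambda'$. $\mathcal{G}_{\Lambda'}=\ker(H_{\Lambda'})\subseteq\mathcal{H}_{\Lambda'}$ is the ground state space, and for $\Lambda'\subseteq\Lambda$, $G_{\Lambda'}$ denotes the orthogonal projection of $\mathcal{H}_\Lambda$ onto $\mathcal{G}_{\Lambda'}\otimes\mathcal{H}_{\Lambda\setminus\Lambda'}$. For a subspace $\mathcal{W}\subseteq\mathcal{H}_\Lambda$ and operator $A$, $\|A\|_{\mathcal{W}}=\sup_{0\neq\psi\in\mathcal{W}}\|A\psi\|/\|\psi\|$, and $\|A\|_{\mathcal{W}}=0$ if $\mathcal{W}=\{0\}$; $E_n\mathcal{V}_\Lambda=\{E_n\psi:\psi\in\mathcal{V}_\Lambda\}$. *)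

(* Defs.v *)
From HB Require Import structures.
From mathcomp Require Import all_boot all_order all_algebra.
From mathcomp Require Import sesquilinear finmap complex.
From mathcomp Require Import classical_sets reals.

Set Implicit Arguments.
Unset Strict Implicit.
Unset Printing Implicit Defensive.

Import Order.TTheory GRing.Theory Num.Theory.
Local Open Scope ring_scope.
Local Open Scope complex_scope.

Section HilbertSpace.
Variables (R : realType) (Gam : choiceType) (dim : Gam -> nat).
Local Notation C := R[i].
Implicit Types (L Y : {fset Gam}).

Definition config L := {dffun forall x : L, 'I_(dim (val x))}.

(* The tensor product of the spaces C^(dim x) for x in L, in coordinates with
   respect to its product basis, which is indexed by config L. *)
Definition hilb L := {ffun config L -> C^o}.
HB.instance Definition _ L := Vector.on (hilb L).

(* hdot is linear in its first argument, as sesquilinear.v requires of a form;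
   the inner product <phi, psi> of physics, antilinear in phi, is
   hdot psi phi. *)
Definition hdot L (psi phi : hilb L) : C :=
  \sum_(s : config L) psi s * (phi s)^*%R.

Lemma hdot_bilinear L :
  bilinear_for (GRing.Scale.Law.clone _ _ *%R _)
    (GRing.Scale.Law.clone _ _ (Num.conj \; *%R) _) (@hdot L).
Proof.
split=> [u|v] a x y /=; rewrite /hdot /= mulr_sumr -big_split /=;
  apply: eq_bigr => s _; rewrite !ffunE.
- by rewrite mulrDl mulrA.
- by rewrite rmorphD rmorphM mulrDr mulrCA.
Qed.

HB.instance Definition _ L :=
  bilinear_isBilinear.Build C _ _ _ _ _ (@hdot L) (@hdot_bilinear L).

Lemma hdot_hermitian L (psi phi : hilb L) :
  hdot psi phi = (-1) ^+ false * (hdot phi psi)^*%R.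
Proof.
rewrite expr0 mul1r /hdot rmorph_sum; apply: eq_bigr => s _.
by rewrite rmorphM /= conjCK mulrC.
Qed.

HB.instance Definition _ L :=
  @isHermitianSesquilinear.Build _ _ _ _ _ (@hdot_hermitian L).

Lemma hdot_gt0 L (psi : hilb L) : psi != 0 -> 0 < hdot psi psi.
Proof.
move=> psi0; have nonneg s : 0 <= psi s * (psi s)^*%R by exact: mul_conjC_ge0.
rewrite lt_def sumr_ge0 ?andbT//; apply: contra psi0.
rewrite psumr_eq0// => /allP h; apply/eqP/ffunP => s; rewrite ffunE.
by have := h s (mem_index_enum _); rewrite /= mul_conjC_eq0 => /eqP.
Qed.

HB.instance Definition _ L := isDotProduct.Build _ _ (@hdot L) (@hdot_gt0 L).

Definition hnorm L (psi : hilb L) : R := Num.sqrt (complex.Re (hdot psi psi)).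

(* The expectation <psi, A psi>. *)
Definition expect L (A : 'End(hilb L)) (psi : hilb L) : C := hdot (A psi) psi.

(* The order on R[i] compares complex numbers with the same imaginary part, so
   that op_le A B says that B - A is self-adjoint and nonnegative. *)
Definition op_le L (A B : 'End(hilb L)) :=
  forall psi, expect A psi <= expect B psi.

Definition selfadjoint L (A : 'End(hilb L)) :=
  forall psi phi, hdot (A psi) phi = hdot psi (A phi).

Definition perp L (W : {vspace hilb L}) : {vspace hilb L} :=
  orthov (@hdot L) W.

(* hdot is positive definite, so W and perp W are complementary. *)
Definition orthoproj L (W : {vspace hilb L}) : 'End(hilb L) :=
  daddv_pi W (perp W).

(* The seminorm ||A||_W of A relative to the subspace W. *)
Definition norm_on L (A : 'End(hilb L)) (W : {vspace hilb L}) : R :=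
  if W == 0%VS then 0 else
  sup [set r | exists psi,
         [/\ psi \in W, psi != 0 & r = hnorm (A psi) / hnorm psi]].

Definition restr Y L (sYL : (Y `<=` L)%fset) (s : config L) : config Y :=
  [ffun x : Y => s (fincl sYL x)].

(* The product vector phi (x) chi. *)
Definition tens Y L (sYL : (Y `<=` L)%fset)
    (phi : hilb Y) (chi : hilb (L `\` Y)%fset) : hilb L :=
  [ffun s : config L => phi (restr sYL s) * chi (restr (fsubsetDl L Y) s)].

Definition ket L (s : config L) : hilb L := [ffun t => (t == s)%:R].

Section Extension.
Variables (Y L : {fset Gam}) (sYL : (Y `<=` L)%fset).

Definition extend_fun (A : 'End(hilb Y)) (psi : hilb L) : hilb L :=
  \sum_(s : config L)
    psi s *: tens sYL (A (ket (restr sYL s)))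
                      (ket (restr (fsubsetDl L Y) s)).

Lemma extend_fun_linear A : linear (extend_fun A).
Proof.
move=> a psi phi; rewrite /extend_fun scaler_sumr -big_split /=.
by apply: eq_bigr => s _; rewrite !ffunE scalerDl scalerA.
Qed.

HB.instance Definition _ A :=
  GRing.isLinear.Build C (hilb L) (hilb L) _ (extend_fun A)
    (extend_fun_linear A).

(* A (x) 1, given by its values on the product basis; see extend_tens. *)
Definition extend (A : 'End(hilb Y)) : 'End(hilb L) := linfun (extend_fun A).

(* The subspace W (x) hilb (L \ Y) of hilb L. *)
Definition tens_space (W : {vspace hilb Y}) : {vspace hilb L} :=
  <<[seq tens sYL phi chi | phi <- vbasis W,
                            chi <- vbasis {:hilb (L `\` Y)%fset}]>>%VS.

Definition merge (t : config Y) (u : config (L `\` Y)%fset) : config L :=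
  [ffun x : L =>
    match decP (@idP (val x \in Y)) return 'I_(dim (val x)) with
    | left xY => t [` xY]%fset
    | right xNY =>
        u [` introT (fsetDP _ _ _) (conj (valP x) (introN idP xNY))]%fset
    end].

Lemma restr_merge t u : restr sYL (merge t u) = t.
Proof.
apply/ffunP => x; rewrite !ffunE; case: (decP _) => [xY|].
  by case: x xY => x xin /= xY; rewrite (bool_irrelevance xY xin).
by case; rewrite /= (valP x).
Qed.

Lemma restrD_merge t u : restr (fsubsetDl L Y) (merge t u) = u.
Proof.
apply/ffunP => x; rewrite !ffunE; case: (decP _) => [xY|xNY].
  by exfalso; have /fsetDP[_ /negP] := valP x; apply.
case: x xNY => x xin /= xNY.
by set e := introT _ _; rewrite (bool_irrelevance e xin).
Qed.

Lemma mergeK s : merge (restr sYL s) (restr (fsubsetDl L Y) s) = s.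
Proof.
apply/ffunP => x; rewrite !ffunE.
case: (decP _) => h; rewrite ffunE; case: x h => x xin /= h.
  by rewrite /fincl; set e := fsubsetP _ _ _; rewrite (bool_irrelevance e xin).
by rewrite /fincl; set e := fsubsetP _ _ _; rewrite (bool_irrelevance e xin).
Qed.

Lemma hilbZ Z (a : C) (f : hilb Z) s : (a *: f) s = a * f s.
Proof. exact: ffunE. Qed.

Lemma hilb_sum Z (I : finType) (F : I -> hilb Z) s :
  (\sum_i F i) s = \sum_i F i s.
Proof. exact: sum_ffunE. Qed.

Lemma ket_expand Z (f : hilb Z) : f = \sum_s f s *: ket s.
Proof.
apply/ffunP => t; rewrite hilb_sum (bigD1 t) //= big1 => [|s st].
  by rewrite hilbZ ffunE eqxx mulr1 addr0.
by rewrite hilbZ ffunE eq_sym (negPf st) mulr0.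
Qed.

Lemma extend_tens A phi chi :
  extend A (tens sYL phi chi) = tens sYL (A phi) chi.
Proof.
rewrite lfunE /= /extend_fun; apply/ffunP => r; rewrite sum_ffunE.
rewrite (reindex (fun p => merge p.1 p.2)) /=; last first.
  exists (fun s => (restr sYL s, restr (fsubsetDl L Y) s)) => [[t u]|s] _ /=.
    by rewrite restr_merge restrD_merge.
  exact: mergeK.
rewrite [RHS]ffunE {2}(ket_expand phi) {2}(ket_expand chi) linear_sum !sum_ffunE.
rewrite big_distrlr pair_big /=; apply: eq_bigr => -[t u] _ /=.
rewrite linearZ /= !hilbZ /tens !ffunE restr_merge restrD_merge.
by rewrite mulrACA.
Qed.

End Extension.

Lemma fpowerset_sub L (Y : fpowerset L) : (val Y `<=` L)%fset.
Proof. by rewrite -fpowersetE; apply: valP. Qed.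

Section Model.
Variable h : forall Y, 'End(hilb Y).

Definition nonneg_interaction :=
  forall Y, selfadjoint (h Y) /\ op_le 0 (h Y).

Definition ham L : 'End(hilb L) :=
  \sum_(Y : fpowerset L) extend (fpowerset_sub Y) (h (val Y)).

Definition gspace L : {vspace hilb L} := lker (ham L).

Definition frustration_free := forall L, gspace L != 0%VS.

Definition ham_in Y L (sYL : (Y `<=` L)%fset) : 'End(hilb L) :=
  extend sYL (ham Y).

Definition gproj Y L (sYL : (Y `<=` L)%fset) : 'End(hilb L) :=
  orthoproj (tens_space sYL (gspace Y)).

(* A finite sequence X_1, ..., X_N is given as X : 'I_N -> {fset Gam}, with
   X_(i+1) = X i. *)
Definition first_union N (X : 'I_N -> {fset Gam}) (n : nat) : {fset Gam} :=
  \big[fsetU/fset0]_(i < N | (i < n)%N) X i.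

Lemma first_union_sub L N (X : 'I_N -> {fset Gam}) (sXL : forall i, (X i `<=` L)%fset)
  n : (first_union X n `<=` L)%fset.
Proof.
apply: (big_ind (fun Y => Y `<=` L)%fset) => //.
by move=> A B AL BL; rewrite fsubUset AL.
Qed.

(* The projection for the union of X_1, ..., X_n, with the conventional values
   1 at n = 0 and 0 at n = N + 1. *)
Definition first_gproj L N (X : 'I_N -> {fset Gam})
    (sXL : forall i, (X i `<=` L)%fset) (n : nat) : 'End(hilb L) :=
  if n == 0%N then \1%VF
  else if (n <= N)%N then gproj (first_union_sub sXL n) else 0.

Definition increment L N (X : 'I_N -> {fset Gam})
    (sXL : forall i, (X i `<=` L)%fset) (n : nat) : 'End(hilb L) :=
  first_gproj sXL n - first_gproj sXL n.+1.

End Model.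

End HilbertSpace.

(* Main.v *)
Require Import Defs.
From HB Require Import structures.
From mathcomp Require Import all_boot all_order all_algebra.
From mathcomp Require Import sesquilinear finmap complex.
From mathcomp Require Import classical_sets reals.
From mathcomp Require Import ring lra.

Set Implicit Arguments.
Unset Strict Implicit.
Unset Printing Implicit Defensive.

Import Order.TTheory GRing.Theory Num.Theory.
Local Open Scope ring_scope.
Local Open Scope complex_scope.

(** Let E_n = G_{Lambda_n} - G_{Lambda_{n+1}}.  The increments are mutually
    orthogonal, and they sum to psi because psi is orthogonal to the ground
    space.  Splitting psi = (1 - G_{X_{n+1}}) psi + G_{X_{n+1}} psi gives

      ||E_n psi||^2 = <E_n psi, (1 - G_{X_{n+1}}) psi>
                      + <G_{X_{n+1}} E_n psi, sum_m E_m psi>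

    where only n - l < m <= n contribute, since G_{X_{n+1}} commutes with every
    other E_m: the regions are then nested or disjoint.  Bounding the two terms
    by AM-GM with weights q = 1 - eps sqrt l and sqrt l / eps, and summing over
    n, where each m is hit at most l times, leads to
    q^2 ||psi||^2 <= sum_n ||(1 - G_{X_n}) psi||^2, whose right-hand side is
    controlled by the local gaps.  Positivity of the interaction makes kernels
    of Hamiltonians decrease with the region, and self-adjoint operators with
    disjoint supports commute together with their kernel projections. *)

(** * Projections in a finite-dimensional Hilbert space *)

(* Locked: otherwise a failing match between two projections makes the
   unifier compute with the matrices that represent them. *)
HB.lock Definition proj (R : realType) (H : vectType R[i])
    (form : {dot H for Num.conj}) (W : {vspace H}) : 'End(H) :=
  daddv_pi W (orthov form W).

Section Hilbert.
Variables (R : realType) (H : vectType R[i]) (form : {dot H for Num.conj}).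
Implicit Types (u v w : H) (W : {vspace H}) (A B T : 'End(H)).

Local Notation proj := (proj form).

(* Rewriting needs a constant as head symbol: as a coercion, form would be
   matched against arbitrary applications. *)
Definition ip u v : R[i] := form u v.

Definition perpv W : {vspace H} := orthov form W.

Definition symop T := forall u v, ip (T u) v = ip u (T v).

Lemma ipDl u v w : ip (u + v) w = ip u w + ip v w.
Proof. rewrite /ip; exact: linearDl. Qed.

Lemma ipDr u v w : ip w (u + v) = ip w u + ip w v.
Proof. rewrite /ip; exact: linearDr. Qed.

Lemma ipBl u v w : ip (u - v) w = ip u w - ip v w.
Proof. rewrite /ip; exact: linearBl. Qed.

Lemma ipBr u v w : ip w (u - v) = ip w u - ip w v.
Proof. rewrite /ip; exact: linearBr. Qed.

Lemma ip0l u : ip 0 u = 0.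
Proof. rewrite /ip; exact: linear0l. Qed.

Lemma ip0r u : ip u 0 = 0.
Proof. rewrite /ip; exact: linear0r. Qed.

Lemma ipZl (a : R[i]) u v : ip (a *: u) v = a * ip u v.
Proof. rewrite /ip; exact: linearZl_LR. Qed.

Lemma ipZr (a : R[i]) u v : ip u (a *: v) = a^*%R * ip u v.
Proof. rewrite /ip; exact: linearZr_LR. Qed.

Lemma ipC u v : ip u v = (ip v u)^*%R.
Proof. by rewrite /ip hermC expr0 mul1r. Qed.

Lemma ip_suml (I : Type) (r : seq I) (P : pred I) (F : I -> H) v :
  ip (\sum_(i <- r | P i) F i) v = \sum_(i <- r | P i) ip (F i) v.
Proof. rewrite /ip; exact: linear_sumlz. Qed.

Lemma ip_sumr (I : Type) (r : seq I) (P : pred I) (F : I -> H) v :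
  ip v (\sum_(i <- r | P i) F i) = \sum_(i <- r | P i) ip v (F i).
Proof. rewrite /ip; exact: linear_sumr. Qed.

Lemma ip_ge0 u : 0 <= ip u u.
Proof. exact: (dnorm_ge0 form). Qed.

Lemma ip_eq0 u : (ip u u == 0) = (u == 0).
Proof. exact: (dnorm_eq0 form). Qed.

Lemma symop_sum (I : finType) (F : I -> 'End(H)) :
  (forall i, symop (F i)) -> symop (\sum_i F i).
Proof.
move=> symF u v; rewrite !sum_lfunE ip_suml ip_sumr.
by apply: eq_bigr => i _; rewrite symF.
Qed.

Lemma lkerP A u : reflect (A u = 0) (u \in lker A).
Proof. by rewrite memv_ker; apply: eqP. Qed.

Lemma perpP W u : reflect {in W, forall w, ip u w = 0} (u \in perpv W).
Proof. exact: mem_orthovP. Qed.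

Lemma cap_perpv W : (W :&: perpv W)%VS = 0%VS.
Proof.
apply/eqP; rewrite -subv0; apply/subvP => u; rewrite memv_cap memv0.
by move=> /andP[uW /perpP/(_ _ uW)/eqP]; rewrite ip_eq0.
Qed.

(** Rank-nullity for the map taking [u] to its inner products with a basis of [W]: the kernel is
    [perpv W] and the image has dimension at most [\dim W]. *)
Lemma add_perpv W : (W + perpv W)%VS = fullv.
Proof.
pose f u : 'rV[R[i]]_(\dim W) := \row_i ip u (vbasis W)`_i.
have f_lin : linear f.
  by move=> a u v; apply/rowP => i; rewrite !mxE ipDl ipZl.
pose f' : {linear H -> 'rV[R[i]]_(\dim W)} :=
  HB.pack f (GRing.isLinear.Build _ _ _ _ f f_lin).
have kerE : lker (linfun f') = perpv W.
  apply/vspaceP => u; rewrite memv_ker lfunE; apply/eqP/perpP => [u0 w|uP].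
    move=> /coord_vbasis ->; rewrite ip_sumr big1 // => i _.
    by have /rowP/(_ i) := u0; rewrite !mxE ipZr => ->; rewrite mulr0.
  apply/rowP => i; rewrite !mxE uP ?vbasis_mem //.
  by rewrite mem_nth // size_tuple.
apply/eqP; rewrite eqEdim subvf /= dimv_disjoint_sum ?cap_perpv //.
rewrite -(limg_ker_dim (linfun f') fullv) capfv kerE addnC leq_add2r.
by rewrite (leq_trans (dimvS (subvf _))) // dimvf dim_matrix mul1r.
Qed.

Lemma proj_mem W u : proj W u \in W.
Proof. by rewrite proj.unlock memv_pi. Qed.

Lemma projB W u v :
  proj W (u - v) = proj W u - proj W v.
Proof. exact: linearB. Qed.

Lemma proj_perpv W u : u - proj W u \in perpv W.
Proof.
have uE : proj W u + daddv_pi (perpv W) W u = u.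
  rewrite proj.unlock.
  by apply: daddv_pi_add; rewrite ?cap_perpv // add_perpv memvf.
by rewrite -{1}uE addrC addKr memv_pi.
Qed.

Lemma proj_unique W u w :
  w \in W -> u - w \in perpv W -> proj W u = w.
Proof.
move=> wW uwP; apply/eqP; rewrite -subr_eq0 -memv0 -(cap_perpv W) memv_cap.
rewrite rpredB ?proj_mem //=.
have -> : proj W u - w = (u - w) - (u - proj W u).
  by rewrite opprB [RHS]addrC addrA subrK.
by rewrite rpredB // proj_perpv.
Qed.

Lemma proj_id W u : u \in W -> proj W u = u.
Proof. by move=> uW; apply: proj_unique; rewrite // subrr mem0v. Qed.

Lemma proj_eq0 W u : u \in perpv W -> proj W u = 0.
Proof. by move=> uW; apply: proj_unique; rewrite ?mem0v ?subr0. Qed.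

Lemma proj_fullv : proj {:H} = \1%VF.
Proof. by apply/lfunP => u; rewrite proj_id ?memvf // id_lfunE. Qed.

Lemma proj0 : proj (0%VS : {vspace H}) = 0.
Proof.
apply/lfunP => u; rewrite proj_eq0 ?lfunE //=.
by apply/perpP => w; rewrite memv0 => /eqP ->; rewrite ip0r.
Qed.

Lemma proj_perpl W u v : v \in W -> ip (u - proj W u) v = 0.
Proof. by move: v; apply/perpP/proj_perpv. Qed.

Lemma proj_symop W : symop (proj W).
Proof.
have projl u v : v \in W -> ip (proj W u) v = ip u v.
  by move=> vW; apply/esym/eqP; rewrite -subr_eq0 -ipBl proj_perpl.
move=> u v; rewrite -(projl u) ?proj_mem //.
by rewrite ipC -(projl v) ?proj_mem // -ipC.
Qed.

(** A symmetric [T] that preserves [W] also preserves [perpv W], so it maps the orthogonal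
    decomposition of [u] to that of [T u]. *)
Lemma proj_comm T W u : symop T ->
  (forall w, w \in W -> T w \in W) -> T (proj W u) = proj W (T u).
Proof.
move=> saT TW; apply/esym/proj_unique; first exact/TW/proj_mem.
by apply/perpP => w /TW wW; rewrite -linearB saT proj_perpl.
Qed.

Lemma proj_nested W W' u : (W <= W')%VS ->
  proj W' (proj W u) = proj W u /\
  proj W (proj W' u) = proj W u.
Proof.
move=> /subvP sWW'; have idW w : w \in W -> proj W' w = w.
  by move=> /sWW'; exact: proj_id.
rewrite idW ?proj_mem // -proj_comm ?idW ?proj_mem //.
- exact: proj_symop.
- by move=> w wW; rewrite idW.
Qed.

(** Two uses of [proj_comm]: [B] preserves the kernel of [A], hence commutes with its projection;
    that projection therefore preserves the kernel of [B]. *)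
Lemma proj_lker_comm A B u : symop A -> symop B ->
  (forall v, A (B v) = B (A v)) ->
  proj (lker A) (proj (lker B) u) =
  proj (lker B) (proj (lker A) u).
Proof.
move=> saA saB AB; apply: proj_comm; first exact: proj_symop.
move=> w; rewrite !memv_ker => /eqP Bw.
rewrite proj_comm ?Bw ?linear0 // => v; rewrite !memv_ker AB => /eqP ->.
by rewrite linear0.
Qed.

Lemma symop_ge0_eq0 A u :
  symop A -> (forall v, 0 <= ip (A v) v) -> ip (A u) u = 0 -> A u = 0.
Proof.
(* If A u != 0, the form is negative at u - t A u for small t > 0. *)
move=> saA A0 Au0; apply/eqP/negP => /negP.
set n := ip (A u) (A u); rewrite -ip_eq0 -/n => n_neq0.
have n0 : 0 < n by rewrite lt_def n_neq0 ip_ge0.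
pose m := ip (A (A u)) (A u).
have m0 : 0 <= m by exact: A0.
(* This [t] solves [t * m = n - t * n], which turns the form at [u - t *: A u] into
   [- (t * n + t * (t * n))]. *)
pose t := n / (m + n); have mn0 : 0 < m + n by rewrite ltr_wpDl.
have t0 : 0 < t by rewrite divr_gt0.
have tC : t^*%R = t by apply: CrealP; rewrite realE ltW.
have := A0 (u - t *: A u); rewrite (linearB A) (linearZ_LR A) /=.
rewrite !(ipBl, ipBr, ipZl, ipZr) Au0 (saA (A u)) -/n -/m tC.
have tm : t * m = n - t * n.
  by apply/eqP; rewrite -subr_eq opprK -mulrDr divfK // gt_eqF.
have -> : 0 - t * n - (t * n - t * (t * m)) = - (t * n + t * (t * n)).
  by rewrite tm; ring.
have tn0 : 0 < t * n by rewrite mulr_gt0.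
by rewrite oppr_ge0 lt_geF // addr_gt0 // mulr_gt0.
Qed.

(** * Real part of the inner product and squared norms *)

Definition rdot u v : R := complex.Re (ip u v).
Local Notation nsq u := (rdot u u).

Lemma ReD (x y : R[i]) : complex.Re (x + y) = complex.Re x + complex.Re y.
Proof. by case: x y => [a b] []. Qed.

Lemma rdotC u v : rdot u v = rdot v u.
Proof. by rewrite /rdot ipC; case: (ip v u). Qed.

Lemma rdotDl u v w : rdot (u + v) w = rdot u w + rdot v w.
Proof. by rewrite /rdot ipDl ReD. Qed.

Lemma rdot0l u : rdot 0 u = 0.
Proof. by rewrite /rdot ip0l. Qed.

Lemma rdot0r u : rdot u 0 = 0.
Proof. by rewrite rdotC rdot0l. Qed.

Lemma rdotDr u v w : rdot w (u + v) = rdot w u + rdot w v.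
Proof. by rewrite !(rdotC w) rdotDl. Qed.

Lemma rdotNl u v : rdot (- u) v = - rdot u v.
Proof. by apply/eqP; rewrite -addr_eq0 -rdotDl addNr rdot0l. Qed.

Lemma rdotNr u v : rdot v (- u) = - rdot v u.
Proof. by rewrite !(rdotC v) rdotNl. Qed.

Lemma rdotZl (a : R) u v : rdot (a%:C *: u) v = a * rdot u v.
Proof.
by rewrite /rdot ipZl; case: (ip u v) => x y /=; rewrite mul0r subr0.
Qed.

Lemma rdotZr (a : R) u v : rdot v (a%:C *: u) = a * rdot v u.
Proof. by rewrite !(rdotC v) rdotZl. Qed.

Lemma rdot_sumr (I : Type) (r : seq I) (P : pred I) (F : I -> H) v :
  rdot v (\sum_(i <- r | P i) F i) = \sum_(i <- r | P i) rdot v (F i).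
Proof. by apply: big_morph; [move=> x y; apply: rdotDr | apply: rdot0r]. Qed.

Lemma ip_rdot u : ip u u = (nsq u)%:C.
Proof. by rewrite /rdot RRe_real // realE ip_ge0. Qed.

Lemma nsq_ge0 u : 0 <= nsq u.
Proof. by rewrite -ler0c -ip_rdot ip_ge0. Qed.

Lemma nsq_eq0 u : (nsq u == 0) = (u == 0).
Proof. by rewrite -ip_eq0 ip_rdot (inj_eq (@complexI _) _ 0). Qed.

Lemma nsq_proj_compl W u : ip (u - proj W u) u = (nsq (u - proj W u))%:C.
Proof.
have -> : ip (u - proj W u) u =
    ip (u - proj W u) (u - proj W u) + ip (u - proj W u) (proj W u).
  by rewrite -ipDr subrK.
by rewrite [X in _ + X]proj_perpl ?proj_mem // addr0 ip_rdot.
Qed.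

Lemma nsq_proj_le W u : nsq (proj W u) <= nsq u.
Proof.
have Pu : nsq u = nsq (u - proj W u) + nsq (proj W u).
  have pyth v w : rdot v w = 0 -> nsq (v + w) = nsq v + nsq w.
    by move=> vw; rewrite rdotDl !rdotDr (rdotC w) vw add0r addr0.
  by rewrite -pyth ?subrK // /rdot proj_perpl ?proj_mem.
by rewrite Pu lerDr nsq_ge0.
Qed.

Lemma rdot_amgm (t : R) u v :
  0 < t -> rdot u v <= (t * nsq u + t^-1 * nsq v) / 2.
Proof.
move=> t0; have := nsq_ge0 (t%:C *: u - v).
rewrite !(rdotDl, rdotDr, rdotNl, rdotNr, rdotZl, rdotZr) (rdotC v u) => h.
rewrite -(ler_pM2l t0) -subr_ge0.
suff -> : t * ((t * nsq u + t^-1 * nsq v) / 2) - t * rdot u v =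
    (t * (t * nsq u - rdot u v) - (t * rdot u v - nsq v)) / 2.
  by rewrite divr_ge0.
by field; rewrite gt_eqF.
Qed.

Lemma nsq_sum (I : finType) (P : pred I) (F : I -> H) :
  (forall i j, i != j -> ip (F i) (F j) = 0) ->
  nsq (\sum_(i | P i) F i) = \sum_(i | P i) nsq (F i).
Proof.
move=> F_orth; rewrite rdot_sumr; apply: eq_bigr => i Pi.
rewrite rdotC rdot_sumr (bigD1 i) //= big1 ?addr0 // => j /andP[_ ji].
by rewrite /rdot F_orth // eq_sym.
Qed.

(** * The martingale estimate for a decreasing chain of subspaces *)

Section Martingale.
Variables (N l : nat) (W : nat -> {vspace H}) (K : 'I_N -> {vspace H}).
Variables (eps : R) (psi : H).
Hypothesis W0 : W 0 = fullv.
Hypothesis W_decr : forall m, (W m.+1 <= W m)%VS.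
(** [W m] stands for the ground states of the first [m] regions and [K n] for those of [X n]. If
    [n < m], then [X n] is among these regions; if [m + l <= n.+1], it is disjoint from all of
    them. *)
Hypothesis KW_comm : forall (n : 'I_N) m u,
  ((n < m) || (m + l <= n.+1))%N ->
  proj (K n) (proj (W m) u) = proj (W m) (proj (K n) u).
Hypothesis eps_ge0 : 0 <= eps.
Hypothesis l_gt0 : (0 < l)%N.
Hypothesis eps_lt : eps < 1 / Num.sqrt l%:R.

Let E m u := proj (W m) u - proj (W m.+1) u.

(** Asked at [psi] alone: no invariance of the subspace containing [psi] is available, and [eps]
    controls [K n] only on the image of that subspace under [E n]. *)
Hypothesis K_eps : forall n : 'I_N,
  nsq (proj (K n) (E n psi)) <= eps ^+ 2 * nsq (E n psi).
Hypothesis psi_perp : psi \in perpv (W N).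

Let W_mono m n : (m <= n)%N -> (W n <= W m)%VS.
Proof.
elim: n => [|n IHn]; first by rewrite leqn0 => /eqP ->.
rewrite leq_eqVlt => /orP[/eqP <- //|/IHn]; exact/subv_trans/W_decr.
Qed.

(** For [i < j] the vector [E j y] lies in [W i.+1], hence in [W i]; both projections in [E i] fix
    it, so their difference annihilates it. *)
Let E_orth m n u v : m != n -> ip (E m u) (E n v) = 0.
Proof.
have ltE i j x y : (i < j)%N -> ip (E i x) (E j y) = 0.
  move=> ij; have Ey : E j y \in W i.+1.
    apply: rpredB; first exact/(subvP (W_mono ij))/proj_mem.
    exact/(subvP (W_mono (leqW ij)))/proj_mem.
  rewrite ipBl !proj_symop !proj_id ?subrr //.
  exact: (subvP (W_decr _)).
by rewrite neq_ltn => /orP[/ltE //|/ltE nm]; rewrite ipC nm conjC0.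
Qed.

(** The sum telescopes from [W 0], whose projection is the identity, to [W N], whose projection
    kills [psi]. *)
Let psiE : psi = \sum_(m < N) E m psi.
Proof.
rewrite -(big_mkord predT (fun m => E m psi)).
rewrite (@telescope_sumr_eq _ _ _ (fun m => - proj (W m) psi)) //.
  by rewrite W0 proj_fullv id_lfunE proj_eq0 // oppr0 sub0r opprK.
by move=> m _; rewrite opprK addrC.
Qed.

(** The range [n - l < m <= n], written without truncated subtraction. *)
Let win (n m : 'I_N) := (m <= n < m + l)%N.

(** Outside the window [K n] commutes with the projections on [W m] and [W m.+1], hence with [E m];
    moved past it, it leaves two vectors in the orthogonal ranges of [E n] and [E m]. *)
Let window n : rdot (proj (K n) (E n psi)) psi =
  rdot (proj (K n) (E n psi)) (\sum_(m | win n m) E m psi).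
Proof.
rewrite {2}psiE !rdot_sumr [RHS]big_mkcond /=; apply: eq_bigr => m _.
case: ifP => // /negbT; rewrite negb_and -ltnNge -leqNgt => nm.
have mn : n != m :> nat.
  apply/negP => /eqP e; move: nm; rewrite e ltnn /= leqNgt -ltn_subLR //.
  by rewrite subnn l_gt0.
rewrite /rdot proj_symop /E projB !KW_comm ?E_orth //.
  (* The condition for [m.+1]: here [m + l <= n] is exactly [m.+1 + l <= n.+1]. *)
  by move: nm => /orP[/leqW ->|h]; rewrite ?addSn ?ltnS ?h ?orbT.
by move: nm => /orP[-> //|h]; rewrite (leq_trans h) ?orbT.
Qed.

Let win_card m : (#|[pred n | win n m]| <= l)%N.
Proof.
rewrite cardE -(size_map val) -[leqRHS](size_iota m l) uniq_leq_size //.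
  by rewrite (map_inj_uniq val_inj) enum_uniq.
by move=> _ /mapP[n + ->]; rewrite mem_enum mem_iota.
Qed.

Lemma martingale_bound :
  (1 - eps * Num.sqrt l%:R) ^+ 2 * nsq psi <=
  \sum_(n < N) nsq (psi - proj (K n) psi).
Proof.
set s := Num.sqrt l%:R; set q := 1 - eps * s.
have s0 : 0 < s by rewrite sqrtr_gt0 ltr0n.
have ss : s * s = l%:R by rewrite -expr2 sqr_sqrtr // ler0n.
have q0 : 0 < q by rewrite subr_gt0 -ltr_pdivlMr.
pose a (n : 'I_N) := nsq (E n psi); pose b n := nsq (psi - proj (K n) psi).
pose c n := nsq (\sum_(m | win n m) E m psi).
have Eij (i j : 'I_N) : i != j -> ip (E i psi) (E j psi) = 0.
  by move=> ij; apply: E_orth.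
have S : nsq psi = \sum_n a n by rewrite [in LHS]psiE nsq_sum.
have sum_c : \sum_n c n <= l%:R * \sum_n a n.
  under eq_bigr do rewrite /c nsq_sum //.
  rewrite (exchange_big_dep predT) //= mulr_sumr ler_sum // => m _.
  rewrite sumr_const -[leLHS]mulr_natl ler_wpM2r ?nsq_ge0 // ler_nat.
  exact: win_card.
have step n :
    a n <= (q * a n + q^-1 * b n) / 2 + eps * (s * a n + s^-1 * c n) / 2.
  have aE : a n = rdot (E n psi) psi.
    rewrite {2}psiE rdot_sumr (bigD1 n) //= big1 ?addr0 // => m mn.
    by rewrite /rdot Eij // eq_sym.
  have : rdot (E n psi) psi = rdot (E n psi) (psi - proj (K n) psi) +
      rdot (proj (K n) (E n psi)) psi.
    by rewrite rdotDr rdotNr /rdot -proj_symop addrNK.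
  rewrite -aE {aE} => aS; rewrite [leLHS]aS.
  apply: lerD; first exact: rdot_amgm.
  rewrite window.
  (* The weight [s / eps] needs [eps] positive. If [eps] is 0, then [K_eps] forces
     [proj (K n) (E n psi)] to vanish and the term is 0. *)
  have [e0|e0] := eqVneq eps 0.
    have := K_eps n; rewrite e0 expr0n mul0r.
    rewrite le_eqVlt ltNge nsq_ge0 orbF nsq_eq0.
    by move=> /eqP ->; rewrite rdot0l !mul0r.
  have {}e0 : 0 < eps by rewrite lt_def e0.
  (* With weight [s / eps] the factor [eps ^+ 2] from [K_eps] becomes [eps * s], and the inverse
     weight is [eps / s]. *)
  apply: (le_trans (rdot_amgm _ _ (divr_gt0 s0 e0))).
  rewrite ler_pM2r ?invr_gt0 // invfM invrK mulrDr lerD //.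
    apply: (le_trans (ler_wpM2l (ltW (divr_gt0 s0 e0)) (K_eps n))).
    rewrite le_eqVlt; apply/orP; left; apply/eqP; rewrite /a.
    by field; rewrite gt_eqF.
  by rewrite mulrA (mulrC eps).
suff : q * (q * nsq psi) <= \sum_n b n by rewrite mulrA.
have : \sum_n a n <= \sum_n ((q * a n + q^-1 * b n) / 2 +
    eps * (s * a n + s^-1 * c n) / 2).
  by apply: ler_sum.
rewrite big_split /= -!mulr_suml !big_split /= -!mulr_sumr !big_split /=.
rewrite -!mulr_sumr -S.
set B := \sum_n b n; set C := \sum_n c n in sum_c *.
rewrite -S in sum_c; set T := nsq psi in sum_c *.
have {sum_c}: s^-1 * C <= s * T by rewrite ler_pdivrMl // mulrA ss.
move=> /(ler_wpM2l eps_ge0) cT TB.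
have : T <= (q * T + q^-1 * B) / 2 + eps * s * T.
  by apply: (le_trans TB); rewrite lerD2l; nra.
(* After this substitution [T] cancels on both sides and [q * T / 2 <= q^-1 * B / 2] remains. *)
have -> : eps * s = 1 - q by rewrite /q opprB addrC subrK.
move=> h; have : q * T <= q^-1 * B by lra.
by rewrite ler_pdivlMl.
Qed.

End Martingale.
End Hilbert.

(* path.merge would be found otherwise. *)
Local Notation merge := Defs.merge.

(** * Operators tensored with the identity *)

Lemma config_irrelevance (Gam : choiceType) (dim : Gam -> nat) (L : {fset Gam})
  (s : config dim L) x (p q : x \in L) : s [` p]%fset = s [` q]%fset.
Proof. by rewrite (bool_irrelevance p q). Qed.

Section Slices.
Variables (R : realType) (Gam : choiceType) (dim : Gam -> nat).
Variables (Y L : {fset Gam}) (sYL : (Y `<=` L)%fset).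
Implicit Types (psi phi : hilb R dim L) (A : 'End(hilb R dim Y)).
Implicit Types (t : config dim Y) (u : config dim (L `\` Y)%fset).
Implicit Types (s : config dim L).

(** The partial inner product of [psi] with the basis vector [ket R u] on the sites outside [Y]. *)
Definition slice u psi : hilb R dim Y := [ffun t => psi (merge t u)].

Lemma slice_is_linear u : linear (slice u).
Proof. by move=> a psi phi; apply/ffunP => t; rewrite !ffunE. Qed.

HB.instance Definition _ u :=
  GRing.isLinear.Build R[i] (hilb R dim L) (hilb R dim Y) _ (slice u)
    (slice_is_linear u).

Lemma tens_slice psi : psi = \sum_u tens sYL (slice u psi) (ket R u).
Proof.
apply/ffunP => s; rewrite hilb_sum (bigD1 (restr (fsubsetDl L Y) s)) //=.
rewrite big1 => [|u us]; rewrite !ffunE; last first.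
  by rewrite eq_sym (negPf us) mulr0.
by rewrite eqxx mulr1 addr0 mergeK.
Qed.

(** Of the expansion [tens_slice] only the component at [u] survives slicing at [u].
    Self-adjointness, positivity and kernels of [extend sYL A] thereby reduce to those of [A]. *)
Lemma extend_slice A u psi : slice u (extend sYL A psi) = A (slice u psi).
Proof.
rewrite {1}(tens_slice psi) !linear_sum /=; apply/ffunP => t.
rewrite hilb_sum (bigD1 u) //= big1 => [|v vu];
  rewrite ffunE extend_tens ffunE restr_merge restrD_merge ffunE.
  by rewrite eqxx mulr1 addr0.
by rewrite eq_sym (negPf vu) mulr0.
Qed.

Lemma extendE A psi s : extend sYL A psi s =
  A (slice (restr (fsubsetDl L Y) s) psi) (restr sYL s).
Proof. by rewrite -extend_slice ffunE mergeK. Qed.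

Lemma hdot_slice psi phi :
  hdot psi phi = \sum_u hdot (slice u psi) (slice u phi).
Proof.
rewrite /hdot exchange_big pair_big /=.
rewrite (reindex (fun p : config dim Y * config dim (L `\` Y)%fset =>
  merge p.1 p.2)) /=; last first.
  exists (fun s => (restr sYL s, restr (fsubsetDl L Y) s)) => [[t u]|s] _ /=.
    by rewrite restr_merge restrD_merge.
  exact: mergeK.
by apply: eq_bigr => -[t u] _; rewrite !ffunE.
Qed.

Lemma extend_selfadjoint A : selfadjoint A -> selfadjoint (extend sYL A).
Proof.
move=> saA psi phi; rewrite !hdot_slice; apply: eq_bigr => u _.
by rewrite !extend_slice saA.
Qed.

Lemma extend_ge0 A : op_le 0 A -> op_le 0 (extend sYL A).
Proof.
move=> A0 psi; rewrite /expect lfunE /= [leLHS]hdot_slice [leRHS]hdot_slice.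
apply: ler_sum => u _; rewrite linear0 extend_slice.
by have := A0 (slice u psi); rewrite /expect lfunE.
Qed.

Lemma extend_sum (I : finType) (F : I -> 'End(hilb R dim Y)) :
  extend sYL (\sum_i F i) = \sum_i extend sYL (F i).
Proof.
apply/lfunP => psi; apply/ffunP => s; rewrite extendE !sum_lfunE !hilb_sum.
by apply: eq_bigr => i _; rewrite extendE.
Qed.

Lemma memv_tens (W : {vspace hilb R dim Y}) (phi : hilb R dim Y)
    (chi : hilb R dim (L `\` Y)%fset) :
  phi \in W -> tens sYL phi chi \in tens_space sYL W.
Proof.
move=> /coord_vbasis ->; rewrite (coord_vbasis (memvf chi)).
set b := vbasis W; set c := vbasis fullv.
have -> : tens sYL (\sum_i coord b i phi *: b`_i)
                   (\sum_j coord c j chi *: c`_j) =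
    \sum_i \sum_j (coord b i phi * coord c j chi) *: tens sYL b`_i c`_j.
  apply/ffunP => s; rewrite ffunE !hilb_sum big_distrlr; apply: eq_bigr => i _.
  by rewrite hilb_sum; apply: eq_bigr => j _; rewrite !hilbZ ffunE mulrACA.
apply: memv_suml => i _; apply: memv_suml => j _; apply/memvZ/memv_span.
by apply: allpairs_f; rewrite mem_nth ?size_tuple.
Qed.

(** If [extend sYL A] kills a vector, then [A] kills its slices, and [tens_slice] writes it as a sum
    of product vectors. This makes [gproj] the projection onto a kernel. *)
Lemma tens_space_lker A : tens_space sYL (lker A) = lker (extend sYL A).
Proof.
apply/eqP; rewrite eqEsubv; apply/andP; split.
  apply/span_subvP => z /allpairsP[[phi chi] /= [/vbasis_mem + _ ->]].
  rewrite !memv_ker => /eqP Aphi; rewrite extend_tens Aphi.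
  by apply/eqP/ffunP => s; rewrite !ffunE mul0r.
apply/subvP => psi; rewrite memv_ker => /eqP Apsi; rewrite (tens_slice psi).
apply: memv_suml => u _; apply: memv_tens.
by rewrite memv_ker -extend_slice Apsi linear0.
Qed.

Lemma restrE s (x : Y) : restr sYL s x = s (fincl sYL x).
Proof. exact: ffunE. Qed.

Lemma merge_in t u (x : L) (xY : val x \in Y) : merge t u x = t [` xY]%fset.
Proof.
rewrite ffunE; case: (decP _) => [xY'|/(_ xY)//].
by rewrite (bool_irrelevance xY' xY).
Qed.

Lemma merge_notin t s (x : L) :
  val x \notin Y -> merge t (restr (fsubsetDl L Y) s) x = s x.
Proof.
move=> xNY; rewrite ffunE.
case: (decP _) => [xY|xNY']; first by rewrite xY in xNY.
by rewrite ffunE; case: x xNY xNY' => x xL ? ?; exact: config_irrelevance.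
Qed.

(** The matrix-entry form: [A] enters through scalars only, so that products of two extended
    operators can be compared as double sums. *)
Lemma extend_ketE A psi s : extend sYL A psi s =
  \sum_t psi (merge t (restr (fsubsetDl L Y) s)) * A (ket R t) (restr sYL s).
Proof.
rewrite extendE {1}[slice _ _]ket_expand linear_sum hilb_sum.
by apply: eq_bigr => t _; rewrite linearZ hilbZ ffunE.
Qed.

End Slices.

Lemma extend_trans (R : realType) (Gam : choiceType) (dim : Gam -> nat)
  (Y Z L : {fset Gam}) (sYZ : (Y `<=` Z)%fset) (sZL : (Z `<=` L)%fset)
  (sYL : (Y `<=` L)%fset) (A : 'End(hilb R dim Y)) :
  extend sZL (extend sYZ A) = extend sYL A.
Proof.
apply/lfunP => psi; apply/ffunP => s.
have restrT : restr sYZ (restr sZL s) = restr sYL s.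
  by apply/ffunP => x; rewrite !restrE; exact: config_irrelevance.
etransitivity; first exact: extendE.
etransitivity; first exact: extendE.
symmetry; etransitivity; first exact: extendE.
rewrite restrT; congr (A _ _); apply/ffunP => t; rewrite !ffunE.
congr (psi _); apply/ffunP => x.
have [xZ|xNZ] := boolP (val x \in Z); last first.
  by rewrite !merge_notin //; apply: contra xNZ; apply/fsubsetP.
rewrite (merge_in _ _ xZ); have [xY|xNY] := boolP (val x \in Y).
  by rewrite !merge_in.
rewrite !merge_notin // restrE; case: x xZ xNY => x xL ? ?.
exact: config_irrelevance.
Qed.

(** Changing a configuration on [Y] does not affect its restriction to a disjoint [Z], and
    conversely, so both products have the same matrix entries. *)
Lemma extend_comm (R : realType) (Gam : choiceType) (dim : Gam -> nat)
  (Y Z L : {fset Gam}) (sYL : (Y `<=` L)%fset) (sZL : (Z `<=` L)%fset)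
  (A : 'End(hilb R dim Y)) (B : 'End(hilb R dim Z)) psi :
  (Y `&` Z)%fset = fset0 ->
  extend sYL A (extend sZL B psi) = extend sZL B (extend sYL A psi).
Proof.
move=> YZ0; have notYZ x : x \in Y -> x \notin Z.
  by move=> xY; apply/negP => xZ; have := in_fset0 x; rewrite -YZ0 inE xY xZ.
have notZY x : x \in Z -> x \notin Y by apply: contraL => /notYZ.
apply/ffunP => s; rewrite [LHS]extend_ketE [RHS]extend_ketE.
under eq_bigr do rewrite extend_ketE mulr_suml.
under [RHS]eq_bigr do rewrite extend_ketE mulr_suml.
rewrite exchange_big; apply: eq_bigr => r _; apply: eq_bigr => t _ /=.
rewrite mulrAC; congr (psi _ * A _ _ * B _ _).
- apply/ffunP => x; have [xZ|xNZ] := boolP (val x \in Z).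
    by rewrite merge_in [RHS]merge_notin ?merge_in // notZY.
  rewrite merge_notin //; have [xY|xNY] := boolP (val x \in Y).
    by rewrite !merge_in.
  by rewrite !merge_notin.
- by apply/ffunP => x; rewrite !restrE [RHS]merge_notin // notYZ // (valP x).
- by apply/ffunP => x; rewrite !restrE merge_notin // notZY // (valP x).
Qed.

(** * Local Hamiltonians and their ground states *)

Section Model.
Variables (R : realType) (Gam : choiceType) (dim : Gam -> nat).
Variable h : forall Y : {fset Gam}, 'End(hilb R dim Y).
Hypothesis h_nonneg : nonneg_interaction h.
Implicit Types (Y Z L : {fset Gam}).

Lemma expect_sum L (I : finType) (F : I -> 'End(hilb R dim L)) psi :
  expect (\sum_i F i) psi = \sum_i expect (F i) psi.
Proof. by rewrite /expect sum_lfunE; exact: (ip_suml (@hdot R Gam dim L)). Qed.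

Lemma op_ge0 L (A : 'End(hilb R dim L)) :
  op_le 0 A <-> forall psi, 0 <= expect A psi.
Proof.
have e0 psi : expect (0 : 'End(hilb R dim L)) psi = 0.
  by rewrite /expect lfunE; exact: (ip0l (@hdot R Gam dim L)).
by split=> A0 psi; have := A0 psi; rewrite e0.
Qed.

Lemma op_ge0_eq0 L (A : 'End(hilb R dim L)) psi :
  selfadjoint A -> op_le 0 A -> expect A psi = 0 -> A psi = 0.
Proof.
move=> saA /op_ge0 A0.
exact: (@symop_ge0_eq0 _ _ (@hdot R Gam dim L) A psi saA A0).
Qed.

Lemma selfadjoint_sum L (I : finType) (F : I -> 'End(hilb R dim L)) :
  (forall i, selfadjoint (F i)) -> selfadjoint (\sum_i F i).
Proof. exact: (@symop_sum _ _ (@hdot R Gam dim L) _ F). Qed.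

Lemma ham_nonneg L : selfadjoint (ham h L) /\ op_le 0 (ham h L).
Proof.
split.
  by apply: selfadjoint_sum => Y; apply/extend_selfadjoint/(h_nonneg _).1.
apply/op_ge0 => psi; rewrite expect_sum sumr_ge0 // => Y _.
by apply/(iffLR (op_ge0 _))/extend_ge0/(h_nonneg _).2.
Qed.

Lemma ham_in_selfadjoint Y L (sYL : (Y `<=` L)%fset) :
  selfadjoint (ham_in h sYL).
Proof. exact/extend_selfadjoint/(ham_nonneg _).1. Qed.

Lemma ham_inE Y L (sYL : (Y `<=` L)%fset) : ham_in h sYL =
  \sum_(Z : fpowerset Y)
    extend (fsubset_trans (fpowerset_sub Z) sYL) (h (val Z)).
Proof.
by rewrite /ham_in extend_sum; apply: eq_bigr => Z _; apply: extend_trans.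
Qed.

(** A sum of nonnegative expectations that is zero has only zero terms, and by positivity each term
    then annihilates [psi]; the terms for [Y] are among those for [Z]. *)
Lemma lker_ham_inS Y Z L (sYL : (Y `<=` L)%fset) (sZL : (Z `<=` L)%fset) :
  (Y `<=` Z)%fset -> (lker (ham_in h sZL) <= lker (ham_in h sYL))%VS.
Proof.
move=> sYZ; apply/subvP => psi /lkerP HZ0; apply/lkerP.
have term0 A (sAL : (A `<=` L)%fset) :
    (A `<=` Z)%fset -> extend sAL (h A) psi = 0.
  move=> sAZ; apply: op_ge0_eq0.
  - exact/extend_selfadjoint/(h_nonneg A).1.
  - exact/extend_ge0/(h_nonneg A).2.
  have : expect (ham_in h sZL) psi = 0.
    by rewrite /expect HZ0; exact: (ip0l (@hdot R Gam dim L)).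
  rewrite ham_inE expect_sum => /eqP; rewrite psumr_eq0; last first.
    by move=> B _; apply/(iffLR (op_ge0 _))/extend_ge0/(h_nonneg _).2.
  have AZ : A \in fpowerset Z by rewrite fpowersetE.
  move=> /allP/(_ [` AZ]%fset (mem_index_enum _))/eqP /=.
  by rewrite (bool_irrelevance (fsubset_trans _ _) sAL).
rewrite ham_inE sum_lfunE; apply: big1 => A _.
exact/term0/(fsubset_trans (fpowerset_sub A)).
Qed.

Lemma gprojE Y L (sYL : (Y `<=` L)%fset) :
  gproj h sYL = proj (@hdot R Gam dim L) (lker (ham_in h sYL)).
Proof. by rewrite proj.unlock /gproj /orthoproj tens_space_lker. Qed.

Lemma gproj_comm Y Z L (sYL : (Y `<=` L)%fset) (sZL : (Z `<=` L)%fset) psi :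
  (Y `&` Z)%fset = fset0 ->
  gproj h sYL (gproj h sZL psi) = gproj h sZL (gproj h sYL psi).
Proof.
move=> YZ0; rewrite !gprojE; apply: proj_lker_comm.
- exact: ham_in_selfadjoint.
- exact: ham_in_selfadjoint.
- by move=> phi; apply: extend_comm.
Qed.

Lemma gproj_nested Y Z L (sYL : (Y `<=` L)%fset) (sZL : (Z `<=` L)%fset) psi :
  (Y `<=` Z)%fset ->
  gproj h sYL (gproj h sZL psi) = gproj h sZL (gproj h sYL psi).
Proof.
move=> sYZ; rewrite !gprojE.
have [PYZ PZY] :=
  proj_nested (@hdot R Gam dim L) psi (lker_ham_inS sYL sZL sYZ).
by etransitivity; [exact: PYZ | exact: esym PZY].
Qed.

End Model.

(** * The seminorm relative to a subspace *)

Section Norms.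
Variables (R : realType) (Gam : choiceType) (dim : Gam -> nat) (L : {fset Gam}).
Local Notation H := (hilb R dim L).
Local Notation nsq u := (rdot (@hdot R Gam dim L) u u).
Implicit Types (u : H) (A : 'End(H)) (U : {vspace H}).

Lemma hnorm_sqr u : hnorm u ^+ 2 = nsq u.
Proof. by rewrite sqr_sqrtr // (nsq_ge0 (@hdot R Gam dim L)). Qed.

Lemma hnorm_ge0 u : 0 <= hnorm u.
Proof. exact: sqrtr_ge0. Qed.

Lemma hnorm_gt0 u : u != 0 -> 0 < hnorm u.
Proof.
move=> u0; rewrite sqrtr_gt0 lt_def (nsq_ge0 (@hdot R Gam dim L)) andbT.
by rewrite (nsq_eq0 (@hdot R Gam dim L)).
Qed.

Lemma hnorm0 : hnorm (0 : H) = 0.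
Proof.
apply/eqP; rewrite -sqrf_eq0 hnorm_sqr.
by rewrite (nsq_eq0 (@hdot R Gam dim L)).
Qed.

Lemma hnorm_proj_le (W : {vspace H}) u :
  hnorm (proj (@hdot R Gam dim L) W u) <= hnorm u.
Proof. exact/ler_wsqrtr/nsq_proj_le. Qed.

(** Contractivity bounds the quotients by 1, so the supremum is a genuine one; the same 1 later
    bounds the family over [n] whose supremum is [eps]. *)
Lemma norm_on_contraction A U : (forall u, hnorm (A u) <= hnorm u) ->
  [/\ 0 <= norm_on A U, norm_on A U <= 1 &
      {in U, forall u, hnorm (A u) <= norm_on A U * hnorm u}].
Proof.
move=> A_contr; rewrite /norm_on; case: ifPn => [/eqP -> | U0].
  split=> // u; rewrite memv0 => /eqP ->.
  by rewrite mul0r -hnorm0 A_contr.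
set E := (X in sup X).
have E1 : ubound E 1.
  move=> _ [u [_ u0 ->]]; rewrite ler_pdivrMr ?hnorm_gt0 // mul1r.
  exact: A_contr.
have EA u : u \in U -> u != 0 -> E (hnorm (A u) / hnorm u).
  by move=> uU u0; exists u.
have hE : has_ubound E by exists 1.
have U1 : vpick U != 0 by rewrite vpick0.
split.
- apply: (le_trans _ (ub_le_sup hE (EA _ (memv_pick U) U1))).
  by rewrite divr_ge0 ?hnorm_ge0.
- apply: ge_sup => //; exists (hnorm (A (vpick U)) / hnorm (vpick U)).
  by apply: EA; rewrite ?memv_pick.
- move=> u uU; have [->|u0] := eqVneq u 0.
    by rewrite linear0 hnorm0 mulr0.
  by rewrite -ler_pdivrMr ?hnorm_gt0 //; apply: ub_le_sup => //; apply: EA.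
Qed.

End Norms.

(** * Ground states of the growing unions *)

Section FirstUnions.
Variables (R : realType) (Gam : choiceType) (dim : Gam -> nat).
Variable h : forall Y : {fset Gam}, 'End(hilb R dim Y).
Hypothesis h_nonneg : nonneg_interaction h.
Variables (L : {fset Gam}) (N : nat) (X : 'I_N -> {fset Gam}).
Variable sXL : forall i : 'I_N, (X i `<=` L)%fset.

Lemma first_unionP m x :
  reflect (exists2 i : 'I_N, (i < m)%N & x \in X i) (x \in first_union X m).
Proof.
apply: (iffP (bigfcupP _ _ _ _)) => [[i /andP[_ im] xi]|[i im xi]];
  exists i => //.
by rewrite mem_index_enum.
Qed.

Lemma sub_first_union (i : 'I_N) m :
  (i < m)%N -> (X i `<=` first_union X m)%fset.
Proof. by move=> im; apply/fsubsetP => x xi; apply/first_unionP; exists i. Qed.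

Lemma first_unionS m : (first_union X m `<=` first_union X m.+1)%fset.
Proof.
apply/fsubsetP => x /first_unionP[i im xi]; apply/first_unionP.
by exists i => //; apply: leqW.
Qed.

(** The ranges of the projections [first_gproj], with the conventional ends; this chain is the [W]
    of the martingale estimate. *)
Definition first_ground m : {vspace hilb R dim L} :=
  if m == 0%N then fullv
  else if (m <= N)%N then lker (ham_in h (first_union_sub sXL m)) else 0%VS.

Lemma first_gprojE m :
  first_gproj h sXL m = proj (@hdot R Gam dim L) (first_ground m).
Proof.
rewrite /first_gproj /first_ground; case: ifP => _.
  exact/esym/proj_fullv.
by case: ifP => _; [exact: gprojE | exact/esym/proj0].
Qed.

Lemma first_groundS m : (first_ground m.+1 <= first_ground m)%VS.
Proof.
case: m => [|m]; first exact: subvf.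
rewrite /first_ground.
have [mN|_] := leqP m.+2 N; last exact: sub0v.
rewrite (ltnW mN).
exact: (lker_ham_inS h_nonneg _ _ (first_unionS _)).
Qed.

(** The regions are nested if [n < m]; otherwise they are disjoint, since [overlap] keeps [X n] away
    from every [X i] with [i + l <= n]. The end values 1 and 0 commute with everything. *)
Lemma gproj_first_comm l (n : 'I_N) m psi :
  (forall i j : 'I_N, (i <= j)%N ->
     (X i `&` X j)%fset != fset0 -> (j < i + l)%N) ->
  ((n < m) || (m + l <= n.+1))%N ->
  gproj h (sXL n) (first_gproj h sXL m psi) =
  first_gproj h sXL m (gproj h (sXL n) psi).
Proof.
move=> overlap; rewrite /first_gproj.
case: ifP => [_ _|_]; first by rewrite !id_lfunE.
case: ifP => [mN|_ _]; last by rewrite !zero_lfunE linear0.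
move=> /orP[nm|nm].
  exact/(gproj_nested h_nonneg)/sub_first_union.
apply: (gproj_comm h_nonneg); apply/fsetP => x; rewrite in_fsetI in_fset0.
apply/negP => /andP[xn /first_unionP[i im xi]].
have il : (i + l <= n)%N.
  by rewrite -ltnS; apply: leq_trans nm; rewrite -addSn leq_add2r.
have := overlap i n (leq_trans (leq_addr _ _) il).
rewrite ltnNge il => /(_ _)/negP; apply=> //.
by apply/fset0Pn; exists x; rewrite in_fsetI xi.
Qed.

(** Every [ham_in h (sXL i)] annihilates a vector of [first_ground N], so the operator inequality
    makes its energy nonpositive, and positivity of [ham h L] puts it in the kernel. *)
Lemma first_ground_sub_gspace :
  op_le (ham h L) (\sum_(i < N) ham_in h (sXL i)) ->
  (first_ground N <= gspace h L)%VS.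
Proof.
move=> ham_le; apply/subvP => psi psiN; apply/lkerP.
have [saH H0] := ham_nonneg h_nonneg L.
apply: op_ge0_eq0 => //; apply/eqP; rewrite eq_le (iffLR (op_ge0 _)) // andbT.
apply: (le_trans (ham_le psi)); rewrite expect_sum big1 // => i _.
(* The index [i] excludes [N = 0], where [first_ground] has its conventional value [fullv]. *)
have N0 : (0 < N)%N by apply: leq_ltn_trans (ltn_ord i).
move: psiN; rewrite /first_ground eqn0Ngt N0 leqnn /=.
move=> /(subvP (lker_ham_inS h_nonneg (sXL i) _ (sub_first_union (ltn_ord i)))).
by move=> /lkerP Hi; rewrite /expect Hi; exact: (ip0l (@hdot R Gam dim L)).
Qed.

End FirstUnions.

(** * From the martingale estimate to the spectral gap *)

Lemma expect_gproj_compl (R : realType) (Gam : choiceType) (dim : Gam -> nat)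
  (h : forall Y : {fset Gam}, 'End(hilb R dim Y)) (Y L : {fset Gam})
  (sYL : (Y `<=` L)%fset) psi :
  expect (\1%VF - gproj h sYL) psi =
  (rdot (@hdot R Gam dim L) (psi - gproj h sYL psi) (psi - gproj h sYL psi))%:C.
Proof.
rewrite /expect add_lfunE opp_lfunE id_lfunE gprojE.
exact: (nsq_proj_compl (@hdot R Gam dim L)).
Qed.

Lemma gproj_contraction (R : realType) (Gam : choiceType) (dim : Gam -> nat)
  (h : forall Y : {fset Gam}, 'End(hilb R dim Y)) (Y L : {fset Gam})
  (sYL : (Y `<=` L)%fset) psi : hnorm (gproj h sYL psi) <= hnorm psi.
Proof. rewrite gprojE; exact: hnorm_proj_le. Qed.

Lemma gproj_increment_bound (R : realType) (Gam : choiceType) (dim : Gam -> nat)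
  (h : forall Y : {fset Gam}, 'End(hilb R dim Y)) (L : {fset Gam})
  (V : {vspace hilb R dim L}) (N : nat) (X : 'I_N -> {fset Gam})
  (sXL : forall i : 'I_N, (X i `<=` L)%fset) (eps : R) :
  eps = sup (range (fun n : 'I_N =>
     norm_on (gproj h (sXL n)) (increment h sXL n @: V)%VS)) ->
  0 <= eps /\ forall (n : 'I_N) psi, psi \in V ->
    let phi := increment h sXL n psi in
    hnorm (gproj h (sXL n) phi) ^+ 2 <= eps ^+ 2 * hnorm phi ^+ 2.
Proof.
move=> ->; set F := fun n => _; set E := range F.
have bound (n : 'I_N) := norm_on_contraction (increment h sXL n @: V)%VS
  (gproj_contraction h (sXL n)).
have ubE : has_ubound E by exists 1 => _ [n _ <-]; have [] := bound n.
have FE n : F n <= sup E by apply: ub_le_sup => //; exists n.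
have F0 n : 0 <= F n by have [] := bound n.
split=> [|n psi psiV].
  (* For [N = 0] the supremum runs over the empty set and has the default value 0. *)
  have [N0|N0] := posnP N; last exact: le_trans (F0 (Ordinal N0)) (FE _).
  suff -> : E = set0 by rewrite sup0.
  by rewrite -subset0 => r [[n nN] _ _]; move: nN; rewrite N0.
have [_ _ /(_ _ (memv_img _ psiV)) phi_le] := bound n.
rewrite /= -exprMn lerXn2r ?nnegrE ?mulr_ge0 ?hnorm_ge0 //.
  exact: le_trans (F0 n) (FE n).
by apply: (le_trans phi_le); apply: ler_wpM2r (FE n); exact: hnorm_ge0.
Qed.

Theorem theorem2p4 (R : realType) (Gam : choiceType) (dim : Gam -> nat)
  (h : forall Y : {fset Gam}, 'End(hilb R dim Y))
  (h_nonneg : nonneg_interaction h)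
  (h_ff : frustration_free h)
  (L : {fset Gam}) (V : {vspace hilb R dim L})
  (V_gs : (V :&: gspace h L)%VS != 0%VS)
  (N : nat) (X : 'I_N -> {fset Gam})
  (sXL : forall i : 'I_N, (X i `<=` L)%fset)
  (gamma : R) (gamma_gt0 : 0 < gamma)
  (local_gap : forall (n : 'I_N) (psi : hilb R dim L), psi \in V ->
     gamma%:C * expect (\1%VF - gproj h (sXL n)) psi
       <= expect (ham_in h (sXL n)) psi)
  (d : R) (d_ge1 : 1 <= d)
  (ham_le : op_le (ham h L) (\sum_(i < N) ham_in h (sXL i)))
  (le_ham : op_le (\sum_(i < N) ham_in h (sXL i)) (d%:C *: ham h L))
  (l : nat) (l_ge1 : (1 <= l)%N)
  (overlap : forall m n : 'I_N, (m <= n)%N ->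
     (X m `&` X n)%fset != fset0 -> (n < m + l)%N)
  (eps : R)
  (epsE : eps = sup (range (fun n : 'I_N =>
     norm_on (gproj h (sXL n)) (increment h sXL n @: V)%VS)))
  (eps_lt : eps < 1 / Num.sqrt l%:R) :
  forall psi : hilb R dim L,
    psi \in (perp (gspace h L) :&: V)%VS ->
    (gamma / d * (1 - eps * Num.sqrt l%:R) ^+ 2 * hnorm psi ^+ 2)%:C
      <= expect (ham h L) psi.
Proof.
move=> psi; rewrite memv_cap => /andP[psi_perp psiV].
have [eps_ge0 eps_bound] := gproj_increment_bound epsE.
pose f : {dot hilb R dim L for Num.conj} := @hdot R Gam dim L.
have W0 : first_ground h sXL 0 = fullv by [].
have KW (n : 'I_N) m u : ((n < m) || (m + l <= n.+1))%N ->
    proj f (lker (ham_in h (sXL n))) (proj f (first_ground h sXL m) u) =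
    proj f (first_ground h sXL m) (proj f (lker (ham_in h (sXL n))) u).
  move=> nm; have := gproj_first_comm h_nonneg sXL u overlap nm.
  by rewrite gprojE first_gprojE.
have K_eps (n : 'I_N) :
    let u := proj f (first_ground h sXL n) psi -
             proj f (first_ground h sXL n.+1) psi in
    rdot f (proj f (lker (ham_in h (sXL n))) u)
           (proj f (lker (ham_in h (sXL n))) u) <=
      eps ^+ 2 * rdot f u u.
  move=> u; have := eps_bound n psi psiV.
  rewrite /= !hnorm_sqr gprojE /increment add_lfunE opp_lfunE !first_gprojE.
  exact.
(* Orthogonality to [gspace h L] passes to the last space of the chain, which it contains by the
   lower bound [ham_le]. *)
have perpN : psi \in perpv f (first_ground h sXL N).
  apply/perpP => w /(subvP (first_ground_sub_gspace h_nonneg ham_le)).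
  by move: w; apply/(perpP f (gspace h L) psi).
have := martingale_bound W0 (first_groundS h_nonneg sXL) KW eps_ge0 l_ge1
  eps_lt K_eps perpN.
set q := 1 - eps * Num.sqrt l%:R; set B := \sum_n _ => qB.
have gamma_le : (gamma * B)%:C <= expect (\sum_(n < N) ham_in h (sXL n)) psi.
  rewrite expect_sum rmorphM rmorph_sum mulr_sumr; apply: ler_sum => n _.
  by have := local_gap n psi psiV; rewrite expect_gproj_compl gprojE.
have d_gt0 : 0 < d by apply: lt_le_trans d_ge1.
have dC_gt0 : 0 < d%:C by rewrite ltcR.
have expectZ : expect (d%:C *: ham h L) psi = d%:C * expect (ham h L) psi.
  rewrite /expect scale_lfunE; exact: (ipZl f).
rewrite -(ler_pM2l dC_gt0) -expectZ.
apply: (le_trans _ (le_trans gamma_le (le_ham psi))).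
rewrite -rmorphM lecR hnorm_sqr.
have -> : d * (gamma / d * q ^+ 2 * rdot f psi psi) =
    gamma * (q ^+ 2 * rdot f psi psi).
  by field; rewrite gt_eqF.
by rewrite ler_pM2l.
Qed.
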